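(* Let $n\ge 2$. For all real antisymmetric $n\times n$ matrices $\theta$ outside a set of Lebesgue measure $0$ (in the space of real antisymmetric $n\times n$ matrices), the following holds: if $\boldsymbol\epsilon\ne\tilde{\boldsymbol\epsilon}$ are two different elements of $\{0,\tfrac12\}^n$, then no irreducible equivariant real spectral triple on $\mathcal{A}(\mathbb{T}^n_\theta)$ with spin structure $\boldsymbol\epsilon$ is unitarily equivalent, via a unitary equivalence inducing an inner automorphism of the algebra, to one with spin structure $\tilde{\boldsymbol\epsilon}$.
   Context: **Notation.** $e(t)=\exp(2\pi it)$. $A(\mathbb{T}^n_\theta)$ is the universal $C^*$-algebra generated by unitaries $U_{\mathbf{x}}$, $\mathbf{x}\in\mathbb{Z}^n$, with $U_{\mathbf{x}}U_{\mathbf{y}}=e(\tfrac12\mathbf{x}\cdot\theta\mathbf{y})U_{\mathbf{x}+\mathbf{y}}$, and $\mathcal{A}(\mathbb{T}^n_\theta)=\{\sum_{\mathbf{x}}a(\mathbf{x})U_{\mathbf{x}}: a\in\mathcal{S}(\mathbb{Z}^n)\}$ with $\mathcal{S}(\mathbb{Z}^n)$ the rapidly decreasing functions on $\mathbb Z^n$ (Schwartz functions). **Real spectral triple with spin structure $\boldsymbol\epsilon$.** For $\boldsymbol\epsilon\in\{0,\tfrac12\}^n$ this is a tuple $(\mathcal{A}(\mathbb{T}^n_\theta),\mathcal{H},D,J,(\Gamma))$ as follows. - $\mathcal{H}$ has orthonormal basis $e_{\boldsymbol\mu,j}$, $\boldsymbol\mu\in\mathbb{Z}^n+\boldsymbol\epsilon$,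 $1\le j\le 2^{\lfloor n/2\rfloor}$, and $\pi(U_{\mathbf{x}})e_{\boldsymbol\mu,j}=e(\tfrac12\mathbf{x}\cdot\mathbf{A}\mathbf{x}+\mathbf{x}\cdot\mathbf{A}\boldsymbol\mu)e_{\boldsymbol\mu+\mathbf{x},j}$ with $\mathbf{A}$ a real matrix such that $\mathbf{A}-\mathbf{A}^t=\theta$. - $De_{\boldsymbol\mu,j}=(\sum_{i=1}^n(\boldsymbol\tau^i\cdot\boldsymbol\mu)A_i+C)e_{\boldsymbol\mu,j}$ where $\boldsymbol\tau^1,\dots,\boldsymbol\tau^n$ are linearly independent in $\mathbb{R}^n$, the $A_i$ are Hermitian $2^{\lfloor n/2\rfloor}\times2^{\lfloor n/2\rfloor}$ matrices with $A_iA_k+A_kA_i=2\delta_{ik}\mathrm{Id}$ (acting on the index $j$), and $C$ is a constant Hermitian matrix with $JCJ^{-1}=\epsilon_DC$ and, if $n$ is even, $\Gamma C=-C\Gamma$. - If $n$ is even, $\Gamma$ is the scalar multiple of $A_1A_2\cdots A_n$ that is self-adjoint and unitary (fixed up to sign). - $J$ is the antilinear isometry $Je_{\boldsymbol\mu,j}=e(\boldsymbol\mu\cdot\mathbf{A}\boldsymbol\mu)\Lambda e_{-\boldsymbol\mu,j}$ with $\Lambda$ a unitary matrix such that $JD=\epsilon_DDJ$, $J^2=\epsilon_J\mathrm{Id}$ and, for $n$ even, $J\Gamma=\epsilon_\Gamma\Gamma J$. For $n\equiv0,\dots,7\pmod 8$: $\epsilon_J=+,+,-,-,-,-,+,+$,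 $\epsilon_D=+,-,+,+,+,-,+,+$; and $\epsilon_\Gamma=+,-,+,-$ for $n\equiv0,2,4,6$. **Unitary equivalence.** A unitary equivalence from $(\mathcal{A},\mathcal{H},D,J,(\Gamma))$ to $(\mathcal{A},\mathcal{H}',D',J',(\Gamma'))$ is a unitary $W:\mathcal{H}\to\mathcal{H}'$ with $W\pi(a)W^{-1}=\pi'(\sigma(a))$ for all $a\in\mathcal{A}$, $WDW^{-1}=D'$, $WJW^{-1}=J'$ (and $W\Gamma W^{-1}=\Gamma'$), where $\sigma$ is a $*$-automorphism of the $C^*$-algebra mapping $\mathcal{A}$ into itself. It induces an inner automorphism if $\sigma(a)=uau^*$ for a unitary $u$ of the $C^*$-algebra $A(\mathbb{T}^n_\theta)$. *)

(* Defs.v *)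
From HB Require Import structures.
From mathcomp Require Import all_boot all_order all_algebra.
From mathcomp Require Import complex finmap.
From mathcomp Require Import all_classical all_reals all_analysis.
From mathcomp Require Import summability.
Import numFieldNormedType.Exports.

Set Implicit Arguments.
Unset Strict Implicit.
Unset Printing Implicit Defensive.

Import Order.TTheory GRing.Theory Num.Theory.

Local Open Scope classical_set_scope.
Local Open Scope ring_scope.

(* A closed box [a, b] in the coordinates (t i j)_{i < j}, which identify the
   antisymmetric n x n matrices with R^(n(n-1)/2); only the entries of a and b
   above the diagonal matter. *)
Definition antisym_mx (R : realType) (n : nat) (t : 'M[R]_n) : Prop :=
  t^T = - t.

Definition antisym_box (R : realType) (n : nat) (a b : 'M[R]_n) :
    set 'M[R]_n :=
  [set t | antisym_mx t /\
     forall i j : 'I_n, (i < j)%N -> a i j <= t i j <= b i j].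

Definition antisym_vol (R : realType) (n : nat) (a b : 'M[R]_n) : R :=
  \prod_(i < n) \prod_(j < n | (i < j)%N) (b i j - a i j).

(* Lebesgue outer measure on the space of antisymmetric matrices. A set has
   Lebesgue measure 0 iff its outer measure is 0. *)
Definition antisym_outer (R : realType) (n : nat) (X : set 'M[R]_n) : \bar R :=
  ereal_inf [set s | exists a b : nat -> 'M[R]_n,
    [/\ (forall k (i j : 'I_n), (i < j)%N -> a k i j <= b k i j),
        X `<=` \bigcup_k antisym_box (a k) (b k)
      & s = (\sum_(0 <= k <oo) (antisym_vol (a k) (b k))%:E)%E]].

Definition antisym_null (R : realType) (n : nat) (X : set 'M[R]_n) : Prop :=
  antisym_outer X = 0%E.

(* Unital C*-algebras. MathComp has no join of rings with normed modules below
   its numeric fields, so the product is carried explicitly on a Banach space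
   rather than through algType. *)
Record cstarAlg (R : realType) := CstarAlg {
  cstar_car :> completeNormedModType R[i];
  cmul : cstar_car -> cstar_car -> cstar_car;
  cone : cstar_car;
  cstar : cstar_car -> cstar_car;
  cmulA : forall x y z, cmul x (cmul y z) = cmul (cmul x y) z;
  cmul1l : forall x, cmul cone x = x;
  cmul1r : forall x, cmul x cone = x;
  cmul_linl : forall (c : R[i]) x y z,
    cmul (c *: x + y) z = c *: cmul x z + cmul y z;
  cmul_linr : forall (c : R[i]) x y z,
    cmul z (c *: x + y) = c *: cmul z x + cmul z y;
  cstarK : forall x, cstar (cstar x) = x;
  cstar_antilin : forall (c : R[i]) x y,
    cstar (c *: x + y) = Num.conj c *: cstar x + cstar y;
  cstar_mul : forall x y, cstar (cmul x y) = cmul (cstar y) (cstar x);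
  cnorm_mul : forall x y, `|cmul x y| <= `|x| * `|y|;
  cnorm_star : forall x, `|cmul (cstar x) x| = `|x| ^+ 2
}.

Arguments cone {R _}.

Definition cunitary (R : realType) (A : cstarAlg R) (u : A) : Prop :=
  cmul (cstar u) u = cone /\ cmul u (cstar u) = cone.

Definition star_hom (R : realType) (A B : cstarAlg R) (f : A -> B) : Prop :=
  [/\ linear f, f cone = cone,
      (forall x y, f (cmul x y) = cmul (f x) (f y))
    & (forall x, f (cstar x) = cstar (f x))].

Definition cstar_subalg (R : realType) (A : cstarAlg R) (S : set A) : Prop :=
  [/\ closed S, S cone,
      (forall (c : R[i]) x y, S x -> S y -> S (c *: x + y)),
      (forall x y, S x -> S y -> S (cmul x y))
    & (forall x, S x -> S (cstar x))].

Definition expi (R : realType) (t : R) : R[i] :=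
  Complex (cos (2 * pi * t)) (sin (2 * pi * t)).

Definition dotv (R : realType) (n : nat) (x y : 'cV[R]_n) : R :=
  (x^T *m y) 0 0.

Definition zvec (R : realType) (n : nat) (x : 'cV[int]_n) : 'cV[R]_n :=
  map_mx (fun k : int => k%:~R) x.
Arguments zvec R {n} x.

Definition nc_torus_family (R : realType) (n : nat) (theta : 'M[R]_n)
    (B : cstarAlg R) (V : 'cV[int]_n -> B) : Prop :=
  (forall x, cunitary (V x)) /\
  forall x y, cmul (V x) (V y) =
    expi (2^-1 * dotv (zvec R x) (theta *m zvec R y)) *: V (x + y).

(* (A, U) is the universal C*-algebra A(T^n_theta) with its generators. *)
Definition is_nc_torus (R : realType) (n : nat) (theta : 'M[R]_n)
    (A : cstarAlg R) (U : 'cV[int]_n -> A) : Prop :=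
  [/\ nc_torus_family theta U,
      (forall S : set A, cstar_subalg S -> (forall x, S (U x)) ->
         forall a, S a)
    & (forall (B : cstarAlg R) (V : 'cV[int]_n -> B),
         nc_torus_family theta V ->
         exists2 phi : A -> B, star_hom phi & forall x, phi (U x) = V x)].

Definition rapidly_decreasing (R : realType) (n : nat)
    (c : 'cV[int]_n -> R[i]) : Prop :=
  forall k : nat, exists M : R[i], forall x : 'cV[int]_n,
    (1 + \sum_(i < n) `|x i 0|)%:~R ^+ k * `|c x| <= M.

(* The dense *-subalgebra of sums \sum_x c(x) U_x with c rapidly decreasing;
   the sums are norm limits along the finite subsets of Z^n. *)
Definition smooth_torus (R : realType) (n : nat) (A : cstarAlg R)
    (U : 'cV[int]_n -> A) : set A :=
  [set a | exists2 c : 'cV[int]_n -> R[i], rapidly_decreasing c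
         & partial_sum (fun x => c x *: U x) @ totally --> a].

(* The inner product is linear in the first argument and antilinear in the
   second one. *)
Record hilbert (R : realType) := Hilbert {
  hilbert_car :> completeNormedModType R[i];
  hdot : {dot hilbert_car for Num.conj};
  hdot_norm : forall v : hilbert_car, `|v| ^+ 2 = hdot v v
}.

Section Operators.
Variables (R : realType) (H H' : hilbert R).

Definition bounded_op (f : H -> H') : Prop :=
  linear f /\ exists M : R[i], forall v, `|f v| <= M * `|v|.

Definition unitary_op (W : H -> H') : Prop :=
  [/\ linear W, (forall w, exists v, W v = w)
    & (forall v w, hdot H' (W v) (W w) = hdot H v w)].

Definition antilinear_isometry (J : H -> H) : Prop :=
  (forall (c : R[i]) v w, J (c *: v + w) = Num.conj c *: J v + J w) /\
  (forall v, `|J v| = `|v|).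

(* The unbounded operator with domain dom and values D v for v in dom; the
   values of D outside of dom are irrelevant. The last clause states that the
   domain of the adjoint is contained in dom. *)
Definition selfadjoint (dom : set H) (D : H -> H) : Prop :=
  [/\ dense dom,
      (forall (c : R[i]) v w, dom v -> dom w -> dom (c *: v + w)),
      (forall (c : R[i]) v w, dom v -> dom w ->
         D (c *: v + w) = c *: D v + D w),
      (forall v w, dom v -> dom w -> hdot H (D v) w = hdot H v (D w))
    & (forall w, (exists z, forall v, dom v -> hdot H (D v) w = hdot H v z) ->
         dom w)].

End Operators.

Definition cstar_rep (R : realType) (A : cstarAlg R) (H : hilbert R)
    (p : A -> H -> H) : Prop :=
  [/\ (forall a, bounded_op (p a)),
      (forall (c : R[i]) a b v, p (c *: a + b) v = c *: p a v + p b v),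
      (forall v, p cone v = v),
      (forall a b v, p (cmul a b) v = p a (p b v))
    & (forall a v w, hdot H (p a v) w = hdot H v (p (cstar a) w))].

(* The data (H, pi, D, J, Gamma). st_pi is the representation of the whole
   C*-algebra (the unique extension of the one of the smooth subalgebra);
   st_Gamma is only used for n even. *)
Record spectral_tuple (R : realType) (A : cstarAlg R) := SpectralTuple {
  st_H : hilbert R;
  st_pi : A -> st_H -> st_H;
  st_dom : set st_H;
  st_D : st_H -> st_H;
  st_J : st_H -> st_H;
  st_Gamma : st_H -> st_H
}.

Definition spin_structure (R : realType) (n : nat) (eps : 'cV[R]_n) : Prop :=
  forall i, eps i 0 = 0 \/ eps i 0 = 2^-1.

Definition shifted_lattice (R : realType) (n : nat) (eps : 'cV[R]_n) :
    set 'cV[R]_n :=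
  [set mu | exists m : 'cV[int]_n, mu = zvec R m + eps].

Definition eps_J (R : realType) (n : nat) : R[i] :=
  nth 0 [:: 1; 1; -1; -1; -1; -1; 1; 1] (n %% 8)%N.
Definition eps_D (R : realType) (n : nat) : R[i] :=
  nth 0 [:: 1; -1; 1; 1; 1; -1; 1; 1] (n %% 8)%N.
(* Only meaningful for n even: the entries stand for n = 0, 2, 4, 6 mod 8. *)
Definition eps_Gamma (R : realType) (n : nat) : R[i] :=
  nth 0 [:: 1; -1; 1; -1] ((n %% 8)./2)%N.
Arguments eps_J : clear implicits.
Arguments eps_D : clear implicits.
Arguments eps_Gamma : clear implicits.

Definition spin_dim (n : nat) : nat := (2 ^ n./2)%N.

Section SpinBasis.
Variables (R : realType) (n : nat) (eps : 'cV[R]_n) (H : hilbert R).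
(* Families e_{mu,j} are total in mu for convenience: only their values on the
   lattice Z^n + eps are constrained or used. *)
Variable e : 'cV[R]_n -> 'I_(spin_dim n) -> H.

Definition orthonormal_basis : Prop :=
  (forall mu nu j k, shifted_lattice eps mu -> shifted_lattice eps nu ->
     hdot H (e mu j) (e nu k) = ((mu == nu) && (j == k))%:R) /\
  dense [set v : H | exists (s : seq ('cV[R]_n * 'I_(spin_dim n)))
                            (c : 'cV[R]_n * 'I_(spin_dim n) -> R[i]),
           (forall p, p \in s -> shifted_lattice eps p.1) /\
           v = \sum_(p <- s) c p *: e p.1 p.2].

(* mact M mu j is M e_{mu,j}, the matrix M acting on the index j. *)
Definition mact (M : 'M[R[i]]_(spin_dim n)) (mu : 'cV[R]_n)
    (j : 'I_(spin_dim n)) : H :=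
  \sum_(k < spin_dim n) M k j *: e mu k.

Definition acts_as (M : 'M[R[i]]_(spin_dim n)) (T : H -> H) : Prop :=
  bounded_op T /\
  forall mu j, shifted_lattice eps mu -> T (e mu j) = mact M mu j.

End SpinBasis.

(* The last arguments are the data entering the formulas for pi, D, J, Gamma:
   the basis e, the matrix A with A - A^t = theta, the vectors tau^i, the
   matrices A_i (here g i), the constant matrix C with the operator Cop by
   which it acts on H, and Lambda. *)
Record spin_triple_axioms (R : realType) (n : nat) (theta : 'M[R]_n)
    (A : cstarAlg R) (U : 'cV[int]_n -> A) (eps : 'cV[R]_n)
    (T : spectral_tuple A)
    (e : 'cV[R]_n -> 'I_(spin_dim n) -> st_H T) (bA : 'M[R]_n)
    (tau : 'I_n -> 'cV[R]_n) (g : 'I_n -> 'M[R[i]]_(spin_dim n))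
    (C : 'M[R[i]]_(spin_dim n)) (Cop : st_H T -> st_H T)
    (Lambda : 'M[R[i]]_(spin_dim n)) : Prop := SpinTripleAxioms {
  sta_basis : orthonormal_basis eps e;

  sta_bA : bA - bA^T = theta;
  sta_rep : cstar_rep (st_pi (s := T));
  sta_pi : forall x mu j, shifted_lattice eps mu ->
    st_pi (U x) (e mu j) =
      expi (2^-1 * dotv (zvec R x) (bA *m zvec R x)
            + dotv (zvec R x) (bA *m mu)) *: e (mu + zvec R x) j;

  sta_tau : row_free (\matrix_(i < n) (tau i)^T);
  sta_g_herm : forall i, g i \is hermsymmx;
  sta_g_clifford : forall i k,
    g i *m g k + g k *m g i = (2 * (i == k)%:R)%:M;
  sta_C_herm : C \is hermsymmx;
  sta_Cop : acts_as eps e C Cop;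
  sta_CJ : forall v, st_J (Cop v) = eps_D R n *: Cop (st_J v);
  sta_CGamma : ~~ odd n -> forall v,
    st_Gamma (Cop v) = - Cop (st_Gamma v);
  sta_D_sa : selfadjoint (@st_dom _ _ T) (@st_D _ _ T);
  sta_D : forall mu j, shifted_lattice eps mu ->
    st_dom (e mu j) /\
    st_D (e mu j) =
      mact e (\sum_(i < n) (dotv (tau i) mu)%:C%C *: g i + C) mu j;

  sta_Gamma : ~~ odd n -> exists c : R[i],
    acts_as eps e (c *: \big[mulmx/1%:M]_(i < n) g i) (@st_Gamma _ _ T);
  sta_Gamma_sa : ~~ odd n -> forall v w,
    hdot _ (st_Gamma v) w = hdot _ v (@st_Gamma _ _ T w);
  sta_Gamma_unitary : ~~ odd n -> unitary_op (@st_Gamma _ _ T);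

  sta_J_isom : antilinear_isometry (@st_J _ _ T);
  sta_Lambda : Lambda \is unitarymx;
  sta_J : forall mu j, shifted_lattice eps mu ->
    st_J (e mu j) = expi (dotv mu (bA *m mu)) *: mact e Lambda (- mu) j;
  sta_JD : forall v : st_H T, st_dom v ->
    st_dom (st_J v) /\ st_J (st_D v) = eps_D R n *: st_D (st_J v);
  sta_JJ : forall v : st_H T, st_J (st_J v) = eps_J R n *: v;
  sta_JGamma : ~~ odd n -> forall v : st_H T,
    st_J (st_Gamma v) = eps_Gamma R n *: st_Gamma (st_J v)
}.

(* T is an irreducible equivariant real spectral triple with spin structure
   eps. *)
Definition real_spectral_triple (R : realType) (n : nat) (theta : 'M[R]_n)
    (A : cstarAlg R) (U : 'cV[int]_n -> A) (eps : 'cV[R]_n)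
    (T : spectral_tuple A) : Prop :=
  exists e bA tau g C Cop Lambda,
    @spin_triple_axioms R n theta A U eps T e bA tau g C Cop Lambda.

(* sigma is a *-automorphism of the C*-algebra mapping the smooth subalgebra
   into itself. Since W is bijective, W x W^-1 = x' is written W x = x' W; for
   the unbounded D this includes the equality of domains. *)
Record unitary_equivalence (R : realType) (n : nat) (A : cstarAlg R)
    (U : 'cV[int]_n -> A) (T T' : spectral_tuple A)
    (W : st_H T -> st_H T') (sigma : A -> A) : Prop := UnitaryEquivalence {
  ueq_unitary : unitary_op W;
  ueq_sigma_hom : star_hom sigma;
  ueq_sigma_bij : bijective sigma;
  ueq_sigma_smooth : forall a, smooth_torus U a -> smooth_torus U (sigma a);
  ueq_pi : forall a v, smooth_torus U a ->
    W (st_pi a v) = st_pi (sigma a) (W v);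
  ueq_dom : forall v, st_dom v <-> st_dom (W v);
  ueq_D : forall v, st_dom v -> W (st_D v) = st_D (W v);
  ueq_J : forall v, W (st_J v) = st_J (W v);
  ueq_Gamma : ~~ odd n -> forall v, W (st_Gamma v) = st_Gamma (W v)
}.

Definition inner_automorphism (R : realType) (A : cstarAlg R)
    (sigma : A -> A) : Prop :=
  exists2 u : A, cunitary u & forall a, sigma a = cmul (cmul u a) (cstar u).

(* Main.v *)
Require Import Defs.
From mathcomp Require Import all_boot all_order all_algebra.
From mathcomp Require Import complex finmap all_classical all_reals all_analysis.
From mathcomp Require Import summability zify lra ring.
Import Order.TTheory GRing.Theory Num.Theory.
Import numFieldNormedType.Exports.
Set Implicit Arguments.
Unset Strict Implicit.
Unset Printing Implicit Defensive.
Local Open Scope classical_set_scope.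
Local Open Scope ring_scope.

(** The idea is that a spin structure can be read off from a family of operators
    that an equivalence inducing an inner automorphism cannot change.

    For a representation pi with real structure J put
    P(a) = pi(a) J pi(a) J, written [bimult] below. On a basis vector
    e_mu the two factors shift mu by x and by -x, so P(U_x) is diagonal:
    P(U_x) e_mu = s e(x . theta mu) e_mu, with s = +1 or -1 the sign of J^2
    ([bimult_basis]). The matrix A has dropped out, only
    theta = A - A^t is left. Since pi(b) and J pi(a) J commute, P is
    multiplicative up to the sign s ([bimultM]).

    Let W be an equivalence inducing a |-> u a u^-1. Then
    W P(U_x) = P'(u U_x u^-1) W, hence P'(u^-1) W carries joint eigenvectors of
    the P(U_x) to joint eigenvectors of the P'(U_x), with the same eigenvalues;
    by multiplicativity P'(u^-1) is invertible, so the images do not vanish.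
    As the basis of the second triple diagonalizes P', some mu in Z^n + eps
    and nu in Z^n + eps' satisfy e(x . theta mu) = e(x . theta nu) for
    all x ([bimult_eigenvalue]). Thus theta k has even integer entries, where
    the integer vector k = 2 (mu - nu) is nonzero because eps and eps' differ.
    For fixed k, with k_i <> 0, and j <> i, the j-th entry of theta k is a
    nonconstant linear form in theta, so each equation (theta k)_j = z defines
    a hyperplane. The exceptional set [resonant] is the countable union of
    these hyperplanes; it is null ([antisym_null_resonant]).

    The commutation of pi(b) with J pi(a) J is a computation on the basis
    when a and b are generators. It passes to the whole C*-algebra, hence to
    the arbitrary unitary u, because the elements that commute, along with
    their adjoints, with a given bounded operator form a closed *-subalgebra
    ([commutant]).
    Closedness rests on the automatic continuity of representations
    ([rep_contractive]). *)

(** * Null sets of antisymmetric matrices *)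

Section NullSets.
Variables (R : realType) (n : nat).
Implicit Types (X : set 'M[R]_n) (a b : 'M[R]_n).

Definition ordered_box a b : Prop := forall i j : 'I_n, (i < j)%N -> a i j <= b i j.

Lemma antisym_vol_ge0 a b : ordered_box a b -> 0 <= antisym_vol a b.
Proof.
move=> ab; apply: prodr_ge0 => i _; apply: prodr_ge0 => j ij.
by rewrite subr_ge0 ab.
Qed.

Lemma antisym_nullP X :
  antisym_null X <-> forall d : R, 0 < d -> exists a b : nat -> 'M[R]_n,
    [/\ forall k, ordered_box (a k) (b k),
        X `<=` \bigcup_k antisym_box (a k) (b k)
      & (\sum_(0 <= k <oo) (antisym_vol (a k) (b k))%:E <= d%:E)%E].
Proof.
rewrite /antisym_null /antisym_outer; set S := [set s | _].
have S0 : lbound S 0%E.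
  move=> _ [a [b [ab _ ->]]]; apply: nneseries_ge0 => k _ _.
  by rewrite lee_fin antisym_vol_ge0//; exact: ab.
split=> [X0 d d0|cov].
  have fS : ereal_inf S \is a fin_num by rewrite X0.
  have [_ [a [b [ab Xab ->]]] sd] := lb_ereal_inf_adherent d0 fS.
  by exists a, b; split=> //; apply: ltW; rewrite X0 add0e in sd.
apply/eqP; rewrite eq_le; apply/andP; split; last exact: le_ereal_inf_tmp.
apply/lee_addgt0Pr => d d0; rewrite add0e.
have [a [b [ab Xab sd]]] := cov _ d0.
by apply: le_trans sd; apply: ereal_inf_lbound; exists a, b.
Qed.

(** The usual argument: cover the i-th set with volume at most d / 2^(i+1) and
    enumerate all the boxes through a bijection of nat with nat * nat. *)
Lemma antisym_null_bigcup (F : nat -> set 'M[R]_n) :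
  (forall i, antisym_null (F i)) -> antisym_null (\bigcup_i F i).
Proof.
move=> F0; apply/antisym_nullP => d d0.
have /choice[G PG] i : exists G : (nat -> 'M[R]_n) * (nat -> 'M[R]_n),
    [/\ forall k, ordered_box (G.1 k) (G.2 k),
        F i `<=` \bigcup_k antisym_box (G.1 k) (G.2 k)
      & (\sum_(0 <= k <oo) (antisym_vol (G.1 k) (G.2 k))%:E
           <= (d / (2 ^ i.+1)%:R)%:E)%E].
  have di : 0 < d / (2 ^ i.+1)%:R by rewrite divr_gt0// ltr0n expn_gt0.
  have [a [b H]] := (antisym_nullP (F i)).1 (F0 i) _ di.
  by exists (a, b).
pose v (p : nat * nat) := (antisym_vol ((G p.1).1 p.2) ((G p.1).2 p.2))%:E.
have v0 p : (0 <= v p)%E.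
  by rewrite lee_fin antisym_vol_ge0//; case: (PG p.1) => + _ _; exact.
have /card_esym/ppcard_eqP[f] := card_nat2.
exists (fun k => (G (f k).1).1 (f k).2), (fun k => (G (f k).1).2 (f k).2).
split=> [k||].
- by case: (PG (f k).1) => + _ _; exact.
- move=> t [i _ Fit]; case: (PG i) => _ /(_ _ Fit)[j _ tj] _.
  by exists (f^-1%FUN (i, j)) => //; rewrite invK ?inE.
- have -> : (\sum_(0 <= k <oo)
      (antisym_vol ((G (f k).1).1 (f k).2) ((G (f k).1).2 (f k).2))%:E)%E
      = (\esum_(p in [set: nat * nat]) v p)%E.
    rewrite nneseries_esumT; last by move=> k; exact: (v0 (f k)).
    by rewrite (reindex_esum setT setT f).
  have -> : [set: nat * nat] = setT `*`` (fun=> setT).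
    by apply/seteqP; split=> [[]|].
  rewrite -(@esum_esum _ _ _ setT (fun=> setT) (fun i j => v (i, j)))//.
  rewrite -nneseries_esumT; last by move=> i; exact: esum_ge0.
  have E := @epsilon_trick R (fun=> 0%E) d xpredT (fun=> lexx _) (ltW d0).
  rewrite [X in (_ <= X + _)%E]eseries0// in E.
  rewrite -[d%:E]add0e; apply: le_trans E; apply: lee_nneseries.
    by move=> i _ _; exact: esum_ge0.
  move=> i _; rewrite -nneseries_esumT ?add0e//.
  by case: (PG i) => _ _ +.
Qed.

Hypothesis n_gt1 : (1 < n)%N.

Lemma antisym_vol_xx a : antisym_vol a a = 0.
Proof.
rewrite /antisym_vol.
rewrite (bigD1 (Ordinal (ltnW n_gt1)))//= (bigD1 (Ordinal n_gt1))//=.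
by rewrite subrr !mul0r.
Qed.

(** A finite cover extends to a sequence by boxes reduced to a point, which have
    volume 0 as soon as there is at least one coordinate above the diagonal. *)
Lemma antisym_null_fincover X :
  (forall d : R, 0 < d -> exists (I : finType) (a b : I -> 'M[R]_n),
    [/\ forall i, ordered_box (a i) (b i),
        X `<=` \bigcup_i antisym_box (a i) (b i)
      & \sum_i antisym_vol (a i) (b i) <= d]) ->
  antisym_null X.
Proof.
move=> cov; apply/antisym_nullP => d /cov[I [a [b [ab Xab sd]]]].
pose s := [seq (a i, b i) | i <- enum I]; pose c := nth (0, 0) s.
have cP k : ordered_box (c k).1 (c k).2.
  rewrite /c; have [ks|ks] := ltnP k (size s); last by rewrite nth_default.
  by have /mapP[i _ ->] := mem_nth (0, 0) ks; exact: ab.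
exists (fun k => (c k).1), (fun k => (c k).2); split=> //.
- move=> t /Xab[i _ ti].
  have /(nthP (0, 0))[k _ ck] : (a i, b i) \in s by rewrite map_f ?mem_enum.
  by exists k => //=; rewrite /c ck.
- apply: lime_le; first by apply: is_cvg_nneseries => k _ _;
    rewrite lee_fin antisym_vol_ge0.
  near=> m; have sm : (size s <= m)%N by near: m; exists (size s).
  rewrite (big_cat_nat (n := size s))//= [X in (_ + X)%E]big_nat_cond.
  rewrite [X in (_ + X)%E]big1 ?adde0 => [|k]; last first.
    by rewrite andbT => /andP[sk _]; rewrite /c nth_default// antisym_vol_xx.
  rewrite -(big_nth (0, 0) xpredT (fun p => (antisym_vol p.1 p.2)%:E)).
  by rewrite big_map big_enum/= sumEFin lee_fin.
Unshelve. all: by end_near. Qed.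

Lemma antisym_null_sub X Y : X `<=` Y -> antisym_null Y -> antisym_null X.
Proof.
move=> XY /antisym_nullP Y0; apply/antisym_nullP => d /Y0[a [b [ab Yab vd]]].
by exists a, b; split=> //; exact: subset_trans Yab.
Qed.

Lemma antisym_null0 : antisym_null (@set0 'M[R]_n).
Proof.
apply: antisym_null_fincover => d d0; exists void, (fun=> 0), (fun=> 0).
by split=> //; rewrite big_pred0 ?ltW// => -[].
Qed.

Lemma antisym_null_bigcup_countable (I : countType) (F : I -> set 'M[R]_n) :
  (forall i, antisym_null (F i)) -> antisym_null (\bigcup_i F i).
Proof.
move=> F0; pose G k := oapp F set0 (choice.unpickle k).
have FG : \bigcup_i F i `<=` \bigcup_k G k.
  by move=> t [i _ Fit]; exists (choice.pickle i) => //; rewrite /G choice.pickleK.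
apply: antisym_null_sub FG _; apply: antisym_null_bigcup => k.
by rewrite /G; case: choice.unpickle => //=; exact: antisym_null0.
Qed.

End NullSets.

(** * Lipschitz graphs and hyperplanes are null *)

Section Graphs.
Variables (R : realType) (n : nat) (n_gt1 : (1 < n)%N).
Implicit Types (X : set 'M[R]_n).

(** X is the graph of an L-Lipschitz function, for the sup norm, expressing the
    coordinate p in terms of the other coordinates above the diagonal. *)
Definition lipschitz_coordinate (p : 'I_n * 'I_n) (L : R) X : Prop :=
  forall t s (h : R), X t -> X s -> 0 <= h ->
    (forall a b : 'I_n, (a < b)%N -> (a, b) != p -> `|t a b - s a b| <= h) ->
    `|t p.1 p.2 - s p.1 p.2| <= L * h.

(** Cut the unit cell into cubes of side 1/r in the coordinates other than p.
    Above each cube the Lipschitz condition confines the coordinate p to an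
    interval of length 2 L / r. With c coordinates other than p there are r^c
    boxes of volume (2 L / r) r^-c each, so the total volume 2 L / r is
    arbitrarily small. *)
Lemma antisym_null_lipschitz_cell X (p : 'I_n * 'I_n) (L : R) (m : 'M[int]_n) :
  (p.1 < p.2)%N -> 0 <= L -> X `<=` @antisym_mx R n ->
  lipschitz_coordinate p L X ->
  (forall t, X t -> forall a b : 'I_n, (a < b)%N ->
     (m a b)%:~R <= t a b < (m a b)%:~R + 1) ->
  antisym_null X.
Proof.
move=> p12 L0 Xanti XL Xm; apply: antisym_null_fincover => // d d0.
have close (z c e u w : R) : z + c <= u <= z + (c + e) ->
    z + c <= w <= z + (c + e) -> `|u - w| <= e.
  by move=> /andP[? ?] /andP[? ?]; apply/ler_normlP; split; lra.
(* The mesh is 1 / r with r > 2 L / d, so that the total volume is below d. *)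
pose k := Num.truncn (2 * L / d); pose r : R := k.+1%:R.
have r0 : 0 < r by rewrite ltr0n.
have Lr : 2 * L / r <= d.
  rewrite ler_pdivrMr// -ler_pdivrMl// mulrC.
  by apply: ltW; apply: truncnS_gt.
pose T := {q : 'I_n * 'I_n | (q.1 < q.2)%N && (q != p)}.
pose cell (g : {ffun T -> 'I_k.+1}) := [set t | X t /\ forall q : T,
  (m (val q).1 (val q).2)%:~R + (g q)%:R / r <= t (val q).1 (val q).2
    <= (m (val q).1 (val q).2)%:~R + (g q).+1%:R / r].
(* A sample point of X above each cube, and 0 when there is none. *)
pose s g := xget 0 (cell g).
pose corner (e : R) (c : nat) (g : {ffun T -> 'I_k.+1}) := \matrix_(i < n, j < n)
  if (i, j) == p then s g i j + e * (L / r)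
  else if insub (i, j) is Some q then (m i j)%:~R + (c + g q)%:R / r else 0.
have insubT' (i j : 'I_n) : (i < j)%N -> (i, j) != p ->
    {q : T | insub (i, j) = Some q & val q = (i, j)}.
  by move=> ij ijp; case: insubP => [q _ vq|/=]; [exists q|rewrite ij ijp].
exists {ffun T -> 'I_k.+1}, (corner (-1) 0%N), (corner 1 1%N); split.
- move=> g i j ij; rewrite !mxE; case: eqP => [_|/eqP ijp].
    have Lr0 : 0 <= L / r by rewrite divr_ge0// ltW.
    by rewrite lerD2l mulN1r mul1r (le_trans _ Lr0)// oppr_le0.
  have [q -> _] := insubT' _ _ ij ijp.
  by rewrite lerD2l ler_pM2r ?invr_gt0// ler_nat.
- move=> t Xt.
  pose gf (q : T) : 'I_k.+1 :=
    inord (Num.truncn (r * (t (val q).1 (val q).2 - (m (val q).1 (val q).2)%:~R))).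
  pose g := [ffun q => gf q].
  have cg : cell g t.
    split=> // q; rewrite ffunE /gf.
    case: q => -[i j] /= /andP[ij ijp]; have /andP[mt tm] := Xm _ Xt _ _ ij.
    set u := t i j in mt tm *; set z := (m i j)%:~R in mt tm *.
    have u0 : 0 <= r * (u - z) by rewrite mulr_ge0 ?subr_ge0// ltW.
    have uk : (Num.truncn (r * (u - z)) < k.+1)%N.
      rewrite truncn_lt_nat// -/r -[ltRHS]mulr1 ltr_pM2l//; lra.
    rewrite inordK//; have /andP[u1 u2] := truncn_itv u0.
    apply/andP; split.
      by rewrite -lerBrDl ler_pdivrMr// [leRHS]mulrC.
    by rewrite -lerBlDl ler_pdivlMr// [leLHS]mulrC ltW.
  have sg : cell g (s g) by apply: xgetPex; exists t.
  exists g => //; split=> [|i j ij]; first exact: Xanti.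
  rewrite !mxE; have [ijp|ijp] := eqVneq (i, j) p.
    have r'0 : 0 <= r^-1 by rewrite invr_ge0 ltW.
    have /ler_normlP/=[] : `|t p.1 p.2 - s g p.1 p.2| <= L * r^-1.
      apply: XL => //; first exact: sg.1.
      move=> a b ab abp; have [q _ vq] := insubT' _ _ ab abp.
      have := cg.2 q; have := sg.2 q; rewrite vq/= -natr1 mulrDl mul1r.
      by move=> sq tq; apply: close tq sq.
    have [-> ->] : i = p.1 /\ j = p.2 by rewrite -ijp.
    move: (t p.1 p.2) (s g p.1 p.2) (L * r^-1) => t' u e.
    by rewrite mulN1r mul1r => ? ?; apply/andP; split; lra.
  have [q -> vq] := insubT' _ _ ij ijp.
  by have := cg.2 q; rewrite vq.
- have volE g : antisym_vol (corner (-1) 0%N g) (corner 1 1%N g)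
      = 2 * L / r * r^-1 ^+ #|{: T}|.
    rewrite /antisym_vol pair_big_dep/= (bigD1 p)//= !mxE -surjective_pairing eqxx.
    congr (_ * _).
      by rewrite mulN1r mul1r opprD opprK addrACA subrr add0r -mulr2n -mulrA mulr_natl.
    rewrite card_sig -prodr_const; apply: eq_bigr => -[i j] /andP[/= ij ijp].
    rewrite !mxE (negbTE ijp); have [q -> _] := insubT' _ _ ij ijp.
    by rewrite add0n add1n -natr1 mulrDl mul1r opprD addrACA subrr add0r addrAC subrr
      add0r.
  under eq_bigr do rewrite volE.
  rewrite sumr_const card_ffun card_ord -[leLHS]mulr_natr natrX exprVn.
  by rewrite -/r mulfVK// expf_neq0// gt_eqF.
Qed.

Lemma antisym_null_lipschitz X (p : 'I_n * 'I_n) (L : R) :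
  (p.1 < p.2)%N -> 0 <= L -> X `<=` @antisym_mx R n ->
  lipschitz_coordinate p L X -> antisym_null X.
Proof.
move=> p12 L0 Xanti XL.
pose F (m : 'M[int]_n) := [set t | X t /\
  forall a b : 'I_n, (a < b)%N -> (m a b)%:~R <= t a b < (m a b)%:~R + 1].
have -> : X = \bigcup_m F m.
  apply/seteqP; split=> [t Xt|t [m _ []]//].
  exists (\matrix_(a, b) Num.floor (t a b)) => //; split=> // a b _.
  by rewrite mxE -[1]/(1%:~R) -intrD; exact: floor_itv.
apply: antisym_null_bigcup_countable => // m.
apply: (antisym_null_lipschitz_cell (m := m) p12 L0).
- by move=> t [/Xanti].
- by move=> t s h [Xt _] [Xs _]; exact: XL.
- by move=> t [].
Qed.

(** As k_i <> 0, the equation expresses the coordinate at (i, j), up to sign, as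
    an affine function of the others, with Lipschitz constant at most
    (sum_l |k_l|) / |k_i|. *)
Lemma antisym_null_hyperplane (k : 'cV[R]_n) (i j : 'I_n) (z : R) :
  i != j -> k i 0 != 0 ->
  antisym_null [set t : 'M[R]_n | antisym_mx t /\ (t *m k) j 0 = z].
Proof.
move=> ij ki0.
(* Coordinates are indexed by pairs above the diagonal, so p is (i, j) or (j, i). *)
wlog [p p12 pE] : / {p : 'I_n * 'I_n | (p.1 < p.2)%N & p = (i, j) \/ p = (j, i)}.
  case: (ltngtP i j) => [l|l|/val_inj e]; last by rewrite e eqxx in ij.
    by apply; exists (i, j) => //; left.
  by apply; exists (j, i) => //; right.
have L0 : 0 <= (\sum_l `|k l 0|) / `|k i 0| by rewrite divr_ge0// sumr_ge0.
apply: (antisym_null_lipschitz p12 L0) => [t []//|].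
have anti (t : 'M[R]_n) a b : antisym_mx t -> t a b = - t b a.
  by move=> /matrixP/(_ b a); rewrite !mxE.
have anti0 (t : 'M[R]_n) a : antisym_mx t -> t a a = 0.
  move=> ta; have /eqP := anti t a a ta; rewrite -addr_eq0 -mulr2n.
  by rewrite mulrn_eq0/= => /eqP.
move=> t s h [ta tz] [sa sz] h0 hts.
have hts' a b : a != b -> (a, b) != (i, j) -> (a, b) != (j, i) ->
    `|t a b - s a b| <= h.
  move=> ab abij abji; case: (ltngtP a b) => [l|l|/val_inj e].
  - by apply: hts => //; case: pE => ->.
  - rewrite anti// (anti s)// -opprD normrN; apply: hts => //.
    by case: pE => ->; rewrite xpair_eqE andbC -xpair_eqE.
  - by rewrite e eqxx in ab.
have -> : `|t p.1 p.2 - s p.1 p.2| = `|t j i - s j i|.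
  by case: pE => -> //=; rewrite anti// (anti s)// -opprD normrN.
rewrite mulrAC ler_pdivlMr ?normr_gt0// -normrM.
have /eqP : (t *m k) j 0 - (s *m k) j 0 = 0 by rewrite tz sz subrr.
rewrite !mxE -sumrB (bigD1 i)//= -mulrBl addr_eq0 => /eqP->; rewrite normrN.
apply: le_trans (ler_norm_sum _ _ _) _.
rewrite mulr_suml big_mkcond/=; apply: ler_sum => l _.
case: eqP => [_|/eqP li]; first by rewrite mulr_ge0.
rewrite -mulrBl normrM mulrC ler_wpM2l//.
have [->|lj] := eqVneq l j.
  by rewrite !(anti0 _ j)// subrr normr0.
by apply: hts'; rewrite ?xpair_eqE ?(negbTE li) ?andbF// eq_sym ?(negbTE ij).
Qed.

End Graphs.

Local Open Scope complex_scope.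

(** * Linear maps and real-valued norms *)

Section Linear.
Variables (K : nzRingType) (V W : lmodType K) (f : V -> W) (lf : linear f).

Lemma lin0 : f 0 = 0.
Proof. by have := lf (-1) 0 0; rewrite scaler0 addr0 scaleN1r addNr. Qed.
Lemma linZ c v : f (c *: v) = c *: f v.
Proof. by have := lf c v 0; rewrite lin0 !addr0. Qed.
Lemma linD v w : f (v + w) = f v + f w.
Proof. by have := lf 1 v w; rewrite !scale1r. Qed.
Lemma linN v : f (- v) = - f v.
Proof. by rewrite -scaleN1r linZ scaleN1r. Qed.
Lemma linB v w : f (v - w) = f v - f w.
Proof. by rewrite linD linN. Qed.
End Linear.

Section Approx.
Variables (R : realType) (V : normedModType R[i]).

(** The norms of normed modules over the complex field take values in that field;
    their real parts make suprema and real arithmetic available. *)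
Definition rnorm (v : V) : R := complex.Re `|v|.

Lemma rnormE v : `|v| = (rnorm v)%:C.
Proof. by rewrite /rnorm RRe_real// normr_real. Qed.

Lemma rnorm_ge0 v : 0 <= rnorm v.
Proof. by rewrite -lecR -rnormE normr_ge0. Qed.

(** Balls of the ambient space have complex radii; this form of closedness needs
    real ones only. *)
Lemma closed_approx (S : set V) :
  (forall v, (forall e : R, 0 < e -> exists2 w, S w & rnorm (v - w) <= e) -> S v) ->
  closed S.
Proof.
move=> h v clv; apply: h => e e0.
have eC : 0 < e%:C by rewrite ltcR.
have [w [Sw /=]] := clv _ (nbhsx_ballx v _ eC).
by rewrite -ball_normE /= rnormE ltcR => /ltW; exists w.
Qed.

Lemma dense_approx (S : set V) : dense S ->
  forall v (e : R), 0 < e -> exists2 w, S w & rnorm (v - w) <= e.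
Proof.
move=> dS v e e0; have eC : 0 < e%:C by rewrite ltcR.
have [|w [bw Sw]] := dS (ball v e%:C) _ (ball_open v _).
  by exists v; exact: ballxx.
by exists w => //; move: bw; rewrite -ball_normE /= rnormE ltcR => /ltW.
Qed.

Lemma norm_approx0 v (K : R) : (forall e : R, 0 < e -> rnorm v <= K * e) -> v = 0.
Proof.
move=> h; apply/eqP; rewrite -normr_eq0 rnormE.
suff -> : rnorm v = 0 by [].
apply/eqP; rewrite eq_le rnorm_ge0 andbT.
have K0 : 0 <= K by have := h 1 ltr01; rewrite mulr1; apply: le_trans; exact: rnorm_ge0.
apply/ler_addgt0Pr => e e0; rewrite add0r.
have K1 : 0 < K + 1 by lra.
apply: le_trans (h (e / (K + 1)) _) _; first exact: divr_gt0.
rewrite mulrA ler_pdivrMr// mulrC ler_wpM2l ?ltW//; lra.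
Qed.

Lemma rnorm_triangle u v : rnorm (u + v) <= rnorm u + rnorm v.
Proof. by rewrite -lecR rmorphD/= -!rnormE ler_normD. Qed.

Lemma rnormN u : rnorm (- u) = rnorm u.
Proof. by rewrite /rnorm normrN. Qed.

Lemma rnormB u v : rnorm (u - v) <= rnorm u + rnorm v.
Proof. by rewrite -(rnormN v); exact: rnorm_triangle. Qed.

Lemma rnormBC u v : rnorm (u - v) = rnorm (v - u).
Proof. by rewrite -rnormN opprB. Qed.

Lemma rnormZR (c : R) u : 0 <= c -> rnorm (c%:C *: u) = c * rnorm u.
Proof. by move=> c0; rewrite {1}/rnorm normrZ ger0_norm ?lecR// rnormE -rmorphM. Qed.

End Approx.

Definition rbounded (R : realType) (V W : normedModType R[i]) (f : V -> W) :=
  exists2 M : R, 0 <= M & forall v, rnorm (f v) <= M * rnorm v.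

Lemma rbounded_comp (R : realType) (U V W : normedModType R[i])
    (f : V -> W) (g : U -> V) : rbounded f -> rbounded g -> rbounded (f \o g).
Proof.
move=> [M M0 fM] [N N0 gN]; exists (M * N) => [|v]; first exact: mulr_ge0.
by apply: le_trans (fM _) _; rewrite -mulrA ler_wpM2l.
Qed.

Lemma bounded_rbounded (R : realType) (H H' : hilbert R) (f : H -> H') :
  bounded_op f -> rbounded f.
Proof.
move=> [_ [M bM]]; exists (`|complex.Re M|) => // v.
rewrite -lecR rmorphM/= -!rnormE.
have [v0|v0] := eqVneq (`|v|) 0.
  by have := bM v; rewrite v0 !mulr0.
apply: le_trans (bM v) _; rewrite ler_wpM2r//.
have M0 : 0 <= M.
  have := le_trans (normr_ge0 (f v)) (bM v).
  by rewrite pmulr_lge0// lt_def v0 normr_ge0.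
by rewrite -[leLHS]RRe_real ?ger0_real// lecR ler_norm.
Qed.

(** * Left inverses in a Banach algebra *)

Section Cstar.
Variables (R : realType) (A : cstarAlg R).
Implicit Types x y z : A.

Lemma cmulBl x y z : cmul (x - y) z = cmul x z - cmul y z.
Proof. by apply: (@linB _ _ _ (fun x => cmul x z)) => c u v; exact: cmul_linl. Qed.
Lemma cmulBr x y z : cmul z (x - y) = cmul z x - cmul z y.
Proof. by apply: (@linB _ _ _ (cmul z)) => c u v; exact: cmul_linr. Qed.

(** |x|^2 = |x^* x| <= |x^*| |x| gives one inequality; the other one follows by
    exchanging x and x^*. *)
Lemma cnorm_cstar x : `|cstar x| = `|x|.
Proof.
have le y : `|y| <= `|cstar y|.
  have [->|y0] := eqVneq (`|y|) 0; first exact: normr_ge0.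
  have yp : 0 < `|y| by rewrite lt_def y0 normr_ge0.
  by rewrite -(ler_pM2r yp) -expr2 -cnorm_star cnorm_mul.
by apply/eqP; rewrite eq_le le andbT -{2}(cstarK x) le.
Qed.

Lemma cstar_one : cstar cone = cone :> A.
Proof. by rewrite -[LHS]cmul1l -{1}(cstarK cone) -cstar_mul cmul1l cstarK. Qed.

Lemma cstarB x y : cstar (x - y) = cstar x - cstar y.
Proof. by rewrite addrC -scaleN1r cstar_antilin rmorphN1 scaleN1r addrC. Qed.

Lemma rnorm_cmul x y : rnorm (cmul x y) <= rnorm x * rnorm y.
Proof. by rewrite -lecR rmorphM/= -!rnormE cnorm_mul. Qed.

Lemma rnorm_cstar x : rnorm (cstar x) = rnorm x.
Proof. by rewrite /rnorm cnorm_cstar. Qed.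

(** The geometric series of y. Its partial sums u_k satisfy
    u_(k+1) = 1 + u_k y, and passing to the limit in this recurrence gives
    c = 1 + c y. *)
Lemma neumann_left_inverse y : rnorm y < 1 -> exists c, cmul c (cone - y) = cone.
Proof.
move=> y1; pose q := rnorm y; have q0 : 0 <= q by exact: rnorm_ge0.
pose u k := iter k (fun c => cone + cmul c y) (0 : A).
have uS k : u k.+1 = cone + cmul (u k) y by [].
pose N := rnorm (cone : A); have N0 : 0 <= N by exact: rnorm_ge0.
have du k : rnorm (u k.+1 - u k) <= N * q ^+ k.
  elim: k => [|k IH].
    by rewrite uS /= (@lin0 _ _ _ (fun x => cmul x y)) ?subr0 ?addr0 ?mulr1// => ? ? ?;
       exact: cmul_linl.
  rewrite (uS k.+1) {2}uS opprD addrACA subrr add0r -cmulBl exprSr mulrA.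
  by apply: le_trans (rnorm_cmul _ _) _; rewrite ler_wpM2r.
have q1 : 0 < 1 - q by rewrite subr_gt0.
have ddu k m : rnorm (u (k + m)%N - u k) <= N / (1 - q) * q ^+ k * (1 - q ^+ m).
  elim: m => [|m IH].
    by rewrite addn0 subrr expr0 subrr mulr0 /rnorm normr0.
  rewrite addnS -(subrK (u (k + m)%N) (u _.+1)) -addrA.
  apply: le_trans (rnorm_triangle _ _) _.
  apply: le_trans (lerD (du _) IH) _.
  rewrite le_eqVlt; apply/orP; left; apply/eqP.
  by rewrite exprD exprS; field; rewrite gt_eqF.
have cu : cvg (u @ \oo).
  apply: cauchy_cvg; apply: cauchy_exP => e e0.
  have [eR eR0 eE] : exists2 r : R, 0 < r & e = r%:C.
    by exists (complex.Re e); [rewrite -ltcR|]; rewrite RRe_real// gtr0_real.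
  have K0 : 0 < N / (1 - q) + 1 by rewrite ltr_wpDl ?divr_ge0// ltW.
  have cq : (GRing.exp q : R^nat) @ \oo --> 0 by apply: cvg_expr; rewrite ger0_norm.
  have /cvgrPdist_lt/(_ (eR / (N / (1 - q) + 1))) := cq.
  rewrite divr_gt0// => /(_ isT)[k _ kP]; exists (u k); exists k => // m /= km.
  rewrite -ball_normE /= rnormE eE ltcR rnormBC -(subnKC km).
  apply: le_lt_trans (ddu _ _) _.
  have := kP k (leqnn k); rewrite /= sub0r normrN ger0_norm ?exprn_ge0//.
  rewrite ltr_pdivlMr// mulrC; apply: le_lt_trans.
  rewrite -mulrA ler_pM ?divr_ge0 ?mulr_ge0 ?exprn_ge0 ?(ltW q1) ?subr_ge0//.
  - by rewrite exprn_ile1// ltW.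
  - by rewrite lerDl.
  - by rewrite ler_piMr ?exprn_ge0// gerBl exprn_ge0.
pose c := lim (u @ \oo).
exists c; apply/eqP; rewrite -subr_eq0; apply/eqP.
apply: (@norm_approx0 _ _ _ (1 + q)) => e e0; have eC : 0 < e%:C by rewrite ltcR.
have /cvgrPdist_lt/(_ _ eC)[k _ kP] := cu.
have /ltW := kP k (leqnn k); have /ltW := kP k.+1 (leqnSn k).
rewrite /= !rnormE !lecR -/c => e1 e2.
have -> : cmul c (cone - y) - cone = (c - u k.+1) - cmul (c - u k) y.
  by rewrite cmulBr cmul1r cmulBl uS opprB opprD !addrA subrK addrAC.
apply: le_trans (rnormB _ _) _; rewrite mulrDl mul1r lerD//.
by apply: le_trans (rnorm_cmul _ _) _; rewrite mulrC ler_wpM2l.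
Qed.

End Cstar.

(** * Representations of C*-algebras on Hilbert spaces *)

Section Hilbert.
Variables (R : realType) (H : hilbert R).
Implicit Types u v w : H.

Lemma hdotDl u v w : hdot H (u + v) w = hdot H u w + hdot H v w.
Proof. by rewrite linearDl. Qed.
Lemma hdotBl u v w : hdot H (u - v) w = hdot H u w - hdot H v w.
Proof. by rewrite linearBl. Qed.
Lemma hdotZl c v w : hdot H (c *: v) w = c * hdot H v w.
Proof. by rewrite linearZl_LR. Qed.
Lemma hdot_conj v w : hdot H v w = Num.conj (hdot H w v).
Proof. by rewrite (hermC (hdot H)) expr0 mul1r. Qed.
Lemma hdotBr u v w : hdot H w (u - v) = hdot H w u - hdot H w v.
Proof. by rewrite linearBr. Qed.
Lemma hdotZr c v w : hdot H w (c *: v) = Num.conj c * hdot H w v.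
Proof. by rewrite linearZr_LR. Qed.

Lemma hdot_rnorm v : hdot H v v = (rnorm v ^+ 2)%:C.
Proof. by rewrite -hdot_norm rnormE rmorphXn. Qed.

(** Expand 0 <= | |v|^2 u - <u, v> v |^2. *)
Lemma cauchy_schwarz u v : `|hdot H u v| <= `|u| * `|v|.
Proof.
have [->|v0] := eqVneq v 0.
  by rewrite normr0 mulr0 linear0r normr0.
pose b := hdot H v v; pose a := hdot H u v.
have b0 : 0 < b by rewrite /b -hdot_norm exprn_gt0// normr_gt0.
have cb : Num.conj b = b by rewrite conj_Creal// gtr0_real.
have : 0 <= hdot H (b *: u - a *: v) (b *: u - a *: v).
  by rewrite -hdot_norm exprn_ge0.
rewrite hdotBl !hdotBr !hdotZl !hdotZr -/a -/b cb (hdot_conj v u) -/a.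
rewrite -hdot_norm.
have -> : b * (b * `|u| ^+ 2) - b * (Num.conj a * a)
   - (a * (b * Num.conj a) - a * (Num.conj a * b))
   = b * (b * `|u| ^+ 2 - a * Num.conj a) by ring.
rewrite pmulr_rge0// subr_ge0 -normCK /b -hdot_norm mulrC -exprMn.
by rewrite ler_pXn2r// nnegrE mulr_ge0.
Qed.

End Hilbert.

Section Representation.
Variables (R : realType) (A : cstarAlg R) (H : hilbert R) (p : A -> H -> H).
Hypothesis pP : cstar_rep p.

Lemma rep_lin a : linear (p a).
Proof. by case: pP => + _ _ _ _ => /(_ a)[]. Qed.
Lemma rep_linl v : linear (p^~ v).
Proof. by case: pP => _ + _ _ _ => h c a b; exact: h. Qed.
Lemma rep1 v : p cone v = v.
Proof. by case: pP => _ _ + _ _; exact. Qed.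
Lemma repM a b v : p (cmul a b) v = p a (p b v).
Proof. by case: pP => _ _ _ + _; exact. Qed.
Lemma rep_star a v w : hdot H (p a v) w = hdot H v (p (cstar a) w).
Proof. by case: pP => _ _ _ _ +; exact. Qed.
Lemma rep_rbounded a : rbounded (p a).
Proof. by apply: bounded_rbounded; case: pP => + _ _ _ _; exact. Qed.
Lemma repBl a b v : p (a - b) v = p a v - p b v.
Proof. exact: (linB (rep_linl v)). Qed.

(** Let T = p b, which is self-adjoint, and let t be the supremum of |T w|^2 over
    unit vectors w. If |b|^2 < t then 1 - b^2 / t has a left inverse c, so
    1 - T^2 / t is bounded below by 1 / |p c|. But for unit vectors
    |(1 - T^2 / t) w|^2 <= 1 - |T w|^2 / t, and the right-hand side comes
    arbitrarily close to 0. *)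
Lemma rep_contractive_sa b v : cstar b = b -> rnorm (p b v) <= rnorm b * rnorm v.
Proof.
move=> bb.
pose E := [set r : R | exists2 w : H, rnorm w = 1 & r = rnorm (p b w) ^+ 2].
have [M M0 bM] := rep_rbounded b.
have Eub : has_ubound E.
  exists (M ^+ 2) => _ [w w1 ->].
  by rewrite ler_sqr ?nnegrE ?rnorm_ge0//; have := bM w; rewrite w1 mulr1.
have supP w : rnorm (p b w) ^+ 2 <= sup E * rnorm w ^+ 2.
  have [w0|w0] := eqVneq w 0.
    by rewrite w0 (lin0 (rep_lin b)) /rnorm normr0 expr0n mulr0.
  have nw : 0 < rnorm w by rewrite -ltcR -rnormE normr_gt0.
  have inw : 0 <= (rnorm w)^-1 by rewrite invr_ge0 ltW.
  rewrite -ler_pdivrMr ?exprn_gt0// -expr_div_n.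
  apply: ub_le_sup => //; exists ((rnorm w)^-1%:C *: w).
    by rewrite rnormZR// mulVf// gt_eqF.
  by rewrite (linZ (rep_lin b)) rnormZR// mulrC.
suff supE : sup E <= rnorm b ^+ 2.
  rewrite -ler_sqr ?nnegrE ?mulr_ge0 ?rnorm_ge0//.
  by apply: le_trans (supP v) _; rewrite exprMn ler_wpM2r// sqr_ge0.
rewrite leNgt; apply/negP => tb; set t := sup E in tb supP.
have t0 : 0 < t by apply: le_lt_trans tb; rewrite sqr_ge0.
have En0 : E !=set0.
  by apply/set0P/negP => /eqP E0; move: t0; rewrite /t E0 sup0 ltxx.
pose y := (t^-1)%:C *: cmul b b.
have y1 : rnorm y < 1.
  rewrite rnormZR ?invr_ge0 ?ltW// mulrC ltr_pdivrMr// mul1r.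
  by apply: le_lt_trans tb; rewrite expr2 rnorm_cmul.
have [c cy] := neumann_left_inverse y1.
have [N N0 cN] := rep_rbounded c.
have key r : E r -> 1 <= N ^+ 2 * (1 - r / t).
  move=> [w w1 ->]; set x := w - p y w.
  have xw : p c x = w.
    by rewrite /x -{1}(rep1 w) -repBl -repM cy rep1.
  have := cN x; rewrite xw w1 => Nx.
  have : rnorm x ^+ 2 <= 1 - rnorm (p b w) ^+ 2 / t.
    rewrite -lecR -hdot_rnorm /x.
    have -> : p y w = (t^-1)%:C *: p b (p b w).
      by rewrite /y (linZ (rep_linl w)) repM.
    rewrite hdotBl !hdotBr !hdotZl !hdotZr.
    have -> : hdot H (p b (p b w)) w = (rnorm (p b w) ^+ 2)%:C.
      by rewrite rep_star bb hdot_rnorm.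
    have -> : hdot H w (p b (p b w)) = (rnorm (p b w) ^+ 2)%:C.
      by rewrite -{1}bb -rep_star hdot_rnorm.
    rewrite !hdot_rnorm w1 expr1n.
    rewrite !conj_Creal ?complex_real//.
    rewrite -!rmorphM -!rmorphB/= lecR.
    have := supP (p b w); set s := rnorm (p b w) ^+ 2.
    set z := _ ^+ 2 => zs.
    have : t^-1 * (t^-1 * z) <= t^-1 * s.
      by rewrite ler_pM2l ?invr_gt0// mulrC ler_pdivrMr// mulrC.
    rewrite [s / t]mulrC; lra.
  move=> xs; have x0 := rnorm_ge0 x.
  have : 1 ^+ 2 <= (N * rnorm x) ^+ 2 by rewrite ler_sqr// nnegrE ?ler01 ?mulr_ge0.
  rewrite expr1n exprMn => /le_trans; apply.
  by rewrite ler_wpM2l// sqr_ge0.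
have NN : 0 < N ^+ 2.
  have [r /key] := En0; case: (eqVneq N 0) => [->|n0 _].
    by rewrite expr0n mul0r ler10.
  by rewrite exprn_gt0// lt_def n0.
have : t <= t - t / N ^+ 2.
  apply: ge_sup => // r /key; rewrite -ler_pdivrMl// mulr1 => h.
  have : t * (r / t) <= t * (1 - (N ^+ 2)^-1) by rewrite ler_pM2l//; lra.
  by rewrite mulrBr mulr1 mulrCA mulfV ?mulr1// gt_eqF.
have : 0 < t / N ^+ 2 by rewrite divr_gt0.
lra.
Qed.

(** |p a v|^2 = <p (a^* a) v, v> reduces the claim to the self-adjoint element
    a^* a, whose norm is |a|^2. *)
Lemma rep_contractive a v : rnorm (p a v) <= rnorm a * rnorm v.
Proof.
rewrite -ler_sqr ?nnegrE ?mulr_ge0 ?rnorm_ge0//.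
have sa : cstar (cmul (cstar a) a) = cmul (cstar a) a.
  by rewrite cstar_mul cstarK.
have aa : rnorm (cmul (cstar a) a) = rnorm a ^+ 2.
  by rewrite {1}/rnorm cnorm_star rnormE -rmorphXn.
rewrite exprMn -lecR -hdot_rnorm rep_star -repM.
rewrite -[leLHS]ger0_norm; last by rewrite repM -rep_star hdot_rnorm lecR sqr_ge0.
apply: le_trans (cauchy_schwarz _ _) _.
rewrite !rnormE -rmorphM/= lecR.
apply: le_trans (ler_wpM2l (rnorm_ge0 _) (rep_contractive_sa _ sa)) _.
by rewrite aa mulrCA expr2.
Qed.

Section Commutant.
Variables (I : Type) (U : I -> A).
Hypothesis U_unitary : forall i, cunitary (U i).
Hypothesis U_gen : forall S : set A, cstar_subalg S -> (forall i, S (U i)) ->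
  forall a, S a.

(** The a such that both a and a^* commute with T form a closed *-subalgebra:
    requiring it of a^* as well gives stability under the involution
    without any adjoint of T. A generator belongs to it because
    an operator commuting with a unitary commutes with its inverse. *)
Lemma commutant (T : H -> H) : linear T -> rbounded T ->
  (forall i v, T (p (U i) v) = p (U i) (T v)) ->
  forall a v, T (p a v) = p a (T v).
Proof.
move=> lT [M M0 TM] TU.
pose S1 := [set a | forall v, T (p a v) = p a (T v)].
suff : forall a, (S1 a /\ S1 (cstar a)) by move=> h a; exact: (h a).1.
pose S := [set a | S1 a /\ S1 (cstar a)]; apply: (U_gen (S := S)).
have S1lin (c : R[i]) x y : S1 x -> S1 y -> S1 (c *: x + y).
  move=> Sx Sy v; rewrite (rep_linl v) lT Sx Sy.
  by rewrite (rep_linl (T v)).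
have S1mul x y : S1 x -> S1 y -> S1 (cmul x y).
  by move=> Sx Sy v; rewrite !repM Sx Sy.
split.
- have S1cl a : (forall e : R, 0 < e -> exists2 b, S1 b & rnorm (a - b) <= e) -> S1 a.
    move=> h v; apply/eqP; rewrite -subr_eq0; apply/eqP.
    apply: (@norm_approx0 _ _ _ (M * rnorm v + rnorm (T v))) => e /h[b Sb abe].
    have -> : T (p a v) - p a (T v) = T (p (a - b) v) - p (a - b) (T v).
      by rewrite !repBl (linB lT) Sb opprB addrA subrK.
    apply: le_trans (rnormB _ _) _; rewrite mulrDl; apply: lerD.
      apply: le_trans (TM _) _; rewrite -mulrA ler_wpM2l//.
      apply: le_trans (rep_contractive _ _) _.
      by rewrite mulrC ler_wpM2l// rnorm_ge0.
    apply: le_trans (rep_contractive _ _) _.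
    by rewrite mulrC ler_wpM2l// rnorm_ge0.
  apply: closed_approx => a h; split; apply: S1cl => e /h[b [Sb Sb'] abe].
    by exists b.
  by exists (cstar b) => //; rewrite -cstarB rnorm_cstar.
- by split=> [v|v]; rewrite ?cstar_one !rep1.
- move=> c x y [Sx Sx'] [Sy Sy']; split; first exact: S1lin.
  by rewrite cstar_antilin; exact: S1lin.
- move=> x y [Sx Sx'] [Sy Sy']; split; first exact: S1mul.
  by rewrite cstar_mul; exact: S1mul.
- by move=> x [Sx Sx']; split; rewrite ?cstarK.
- move=> i; split=> [|v]; first exact: TU.
  have [UsU UUs] := U_unitary i.
  rewrite -[LHS]rep1 -{1}UsU repM -TU; congr (p _ _).
  by rewrite -repM UUs rep1.
Qed.
End Commutant.
End Representation.

Section Density.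
Variables (R : realType) (n : nat) (eps : 'cV[R]_n) (H : hilbert R).
Variable e : 'cV[R]_n -> 'I_(spin_dim n) -> H.
Hypothesis eP : orthonormal_basis eps e.

Lemma linear_eq_on_basis (V : normedModType R[i]) (F G : H -> V) :
  linear F -> rbounded F -> linear G -> rbounded G ->
  (forall mu j, shifted_lattice eps mu -> F (e mu j) = G (e mu j)) -> F =1 G.
Proof.
move=> lF [M M0 FM] lG [N N0 GN] FG v; apply/eqP; rewrite -subr_eq0; apply/eqP.
apply: (@norm_approx0 _ _ _ (M + N)) => d /(dense_approx eP.2 v)[w [s [c [sL ->]]]].
set x := \sum_(_ <- _) _ => xd.
have Fx : F x = G x.
  rewrite /x; elim: s sL {x xd} => [|q s IH] sL; first by rewrite big_nil !lin0.
  rewrite big_cons (lF _ _ _) (lG _ _ _) FG ?IH// => [q' q's|].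
    by apply: sL; rewrite in_cons q's orbT.
  by apply: sL; rewrite mem_head.
have -> : F v - G v = F (v - x) - G (v - x).
  by rewrite (linB lF) (linB lG) Fx opprB addrA subrK.
apply: le_trans (rnormB _ _) _; rewrite mulrDl; apply: lerD.
  by apply: le_trans (FM _) _; rewrite ler_wpM2l.
by apply: le_trans (GN _) _; rewrite ler_wpM2l.
Qed.

Lemma hdot_functional (w : H) :
  linear ((fun v => hdot H v w) : H -> R[i]^o) /\
  rbounded ((fun v => hdot H v w) : H -> R[i]^o).
Proof.
split; first by move=> c u v; rewrite hdotDl hdotZl.
exists (rnorm w); first exact: rnorm_ge0.
move=> v; rewrite -lecR rmorphM/= -!rnormE mulrC; exact: cauchy_schwarz.
Qed.

Lemma ortho_basis_eq0 (f : H) :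
  (forall mu j, shifted_lattice eps mu -> hdot H f (e mu j) = 0) -> f = 0.
Proof.
move=> fe; have [l b] := hdot_functional f.
have := @linear_eq_on_basis R[i]^o _ (fun=> 0) l b _ _ _ f.
move=> /(_ _ _ _)/eqP; rewrite dnorm_eq0 => h; apply/eqP; apply: h.
- by move=> c u v; rewrite scaler0 addr0.
- by exists 0 => // v; rewrite mul0r /rnorm normr0.
- by move=> mu j muL; rewrite hdot_conj fe// rmorph0.
Qed.

End Density.

(** * Phases and shifted lattices *)

Section Phases.
Variable R : realType.
Implicit Types s t : R.

Lemma expiD s t : expi (s + t) = expi s * expi t.
Proof.
rewrite /expi mulrDr cosD sinD; apply/eqP; rewrite eq_complex /=.
by rewrite eqxx /= addrC [X in _ + X]mulrC [X in X + _]mulrC mulrC [X in _ + X]mulrC.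
Qed.

Lemma expi0 : expi 0 = 1 :> R[i].
Proof. by rewrite /expi mulr0 cos0 sin0. Qed.

Lemma conj_expi s : Num.conj (expi s) = expi (- s).
Proof. by rewrite /expi mulrN cosN sinN. Qed.

Lemma expi_int (z : int) : expi (z%:~R : R) = 1.
Proof.
have nat_ k : expi (k%:R : R) = 1.
  by elim: k => [|k IH]; rewrite ?expi0// -natr1 expiD IH mul1r /expi mulr1 
     mulr_natl cos2pi sin2pi.
case: z => k; first exact: nat_.
have := expiD (k.+1%:R : R) (Negz k)%:~R.
by rewrite NegzE mulrNz subrr expi0 nat_ mul1r.
Qed.

(** For the fractional part r of s, e(r) = 1 gives
    cos (2 pi r) = 1 - 2 sin^2 (pi r) = 1, while sin (pi r) > 0 unless r = 0. *)
Lemma expi_eq1 s : expi s = 1 -> exists z : int, s = z%:~R.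
Proof.
move=> s1; pose z := Num.floor s; exists z.
pose r := s - z%:~R; have [r0 r1] : 0 <= r /\ r < 1.
  have /andP[] := floor_itv s; rewrite -/z intrD => ? ?.
  by split; rewrite /r; lra.
have : expi r = 1 by rewrite /r -mulrNz expiD s1 expi_int mulr1.
move: r0; rewrite le_eqVlt => /orP[/eqP/esym/eqP|r0]; first by rewrite subr_eq0 => /eqP.
rewrite /expi -mulrA mulr_natl => /(congr1 (@complex.Re R))/=.
rewrite cos_mulr2n cos2sin2 => /eqP.
have : 0 < sin (pi * r).
  by rewrite sin_gt0_pi// mulr_gt0 ?pi_gt0//= gtr_pMr ?pi_gt0.
move=> sp; have : 0 < sin (pi * r) ^+ 2 by rewrite exprn_gt0.
set y := _ ^+ 2; rewrite mulr2n => y0 /eqP ?; lra.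
Qed.

Lemma expi_eq s t : expi s = expi t -> exists z : int, s - t = z%:~R.
Proof.
move=> st; apply: expi_eq1; rewrite expiD st -expiD subrr; exact: expi0.
Qed.

End Phases.

Section Lattice.
Variables (R : realType) (n : nat).

Lemma zvecD (x y : 'cV[int]_n) : zvec R (x + y) = zvec R x + zvec R y.
Proof. by apply/matrixP => i j; rewrite !mxE intrD. Qed.
Lemma zvecN (x : 'cV[int]_n) : zvec R (- x) = - zvec R x.
Proof. by apply/matrixP => i j; rewrite !mxE mulrNz. Qed.

Lemma shifted_latticeD (eps mu : 'cV[R]_n) x :
  shifted_lattice eps mu -> shifted_lattice eps (mu + zvec R x).
Proof. by move=> [m ->]; exists (m + x); rewrite zvecD addrAC. Qed.

Definition half_index (eps : 'cV[R]_n) : 'cV[int]_n := \col_i (eps i 0 != 0)%:Z.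

Lemma double_spin (eps : 'cV[R]_n) : spin_structure eps ->
  eps + eps = zvec R (half_index eps).
Proof.
move=> sp; apply/matrixP => i j.
rewrite !mxE ord1; case: (sp i) => ->; first by rewrite eqxx addr0.
by rewrite invr_neq0// [RHS](splitr 1) mul1r.
Qed.

(** - eps lies in Z^n + eps because 2 eps is integral. *)
Lemma shifted_latticeN (eps mu : 'cV[R]_n) : spin_structure eps ->
  shifted_lattice eps mu -> shifted_lattice eps (- mu).
Proof.
move=> /double_spin ek [m ->]; exists (- m - half_index eps).
by rewrite zvecD !zvecN -ek !opprD addrA addrNK.
Qed.

Lemma dotvDl (x y z : 'cV[R]_n) : dotv (x + y) z = dotv x z + dotv y z.
Proof. by rewrite /dotv linearD mulmxDl mxE. Qed.
Lemma dotvDr (x y z : 'cV[R]_n) : dotv z (x + y) = dotv z x + dotv z y.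
Proof. by rewrite /dotv mulmxDr mxE. Qed.
Lemma dotvNl (x z : 'cV[R]_n) : dotv (- x) z = - dotv x z.
Proof. by rewrite /dotv linearN mulNmx mxE. Qed.
Lemma dotvNr (x z : 'cV[R]_n) : dotv z (- x) = - dotv z x.
Proof. by rewrite /dotv mulmxN mxE. Qed.
Lemma dotvC (x y : 'cV[R]_n) : dotv x y = dotv y x.
Proof. by rewrite /dotv -[in LHS](trmxK y) -trmx_mul mxE. Qed.
Lemma dotv_trmx (M : 'M[R]_n) (x y : 'cV[R]_n) :
  dotv x (M^T *m y) = dotv y (M *m x).
Proof. by rewrite dotvC /dotv trmx_mul trmxK mulmxA. Qed.

End Lattice.

(** The coefficients of U x are a delta function, so the partial sums over the
    finite sets containing x are all equal to U x. *)
Lemma smooth_generator (R : realType) (n : nat) (A : cstarAlg R)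
  (U : 'cV[int]_n -> A) x : smooth_torus U (U x).
Proof.
exists (fun y => (y == x)%:R).
  move=> k; exists ((1 + \sum_(i < n) `|x i 0|)%:~R ^+ k) => y.
  have [->|_] := eqVneq y x; first by rewrite normr1 mulr1.
  by rewrite normr0 mulr0 exprn_ge0// ler0z addr_ge0// sumr_ge0.
apply: cvg_near_cst; first exact: totally_filter.
exists [fset x]%fset => // B /= xB.
rewrite /partial_sum.
have xB' : x \in B by apply: (fsubsetP xB); rewrite inE.
rewrite (bigD1 [` xB']%fset)//= eqxx scale1r big1 ?addr0// => i ix.
case: eqP => [ex|]; last by rewrite scale0r.
by case/negP: ix; apply/eqP/val_inj.
Qed.

(** * The opposite representation given by a real structure *)

(** As J^2 is a sign, J p(a) J is up to that sign J p(a) J^-1, whose values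
    commute with those of p. *)
Definition opposite (R : realType) (A : cstarAlg R) (H : hilbert R)
  (p : A -> H -> H) (J : H -> H) (a : A) (v : H) : H := J (p a (J v)).

Definition bimult (R : realType) (A : cstarAlg R) (H : hilbert R)
  (p : A -> H -> H) (J : H -> H) (a : A) (v : H) : H := p a (opposite p J a v).

Section RealStructure.
Variables (R : realType) (A : cstarAlg R) (H : hilbert R) (p : A -> H -> H).
Variables (J : H -> H) (ej : R[i]).
Hypotheses (pP : cstar_rep p) (JP : antilinear_isometry J).
Hypotheses (ejC : Num.conj ej = ej) (ej2 : ej * ej = 1).
Hypothesis JJ : forall v, J (J v) = ej *: v.

Local Notation op := (opposite p J).
Local Notation P := (bimult p J).

Lemma antilinear0 : J 0 = 0.
Proof. by have := JP.1 (-1) 0 0; rewrite rmorphN1 scaler0 addr0 scaleN1r addNr. Qed.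
Lemma antilinearZ c v : J (c *: v) = Num.conj c *: J v.
Proof. by have := JP.1 c v 0; rewrite antilinear0 !addr0. Qed.

Lemma opposite_linear a : linear (op a).
Proof. by move=> c u v; rewrite /opposite JP.1 (rep_lin pP) JP.1 conjCK. Qed.

Lemma opposite_rbounded a : rbounded (op a).
Proof.
exists (rnorm a); first exact: rnorm_ge0.
move=> v; rewrite /opposite {1}/rnorm JP.2 -/(rnorm _).
by apply: le_trans (rep_contractive pP _ _) _; rewrite /rnorm JP.2.
Qed.

Lemma bimult_linear a : linear (P a).
Proof. by move=> c u v; rewrite /bimult opposite_linear (rep_lin pP). Qed.

Lemma bimult_rbounded a : rbounded (P a).
Proof. exact: rbounded_comp (rep_rbounded pP a) (opposite_rbounded a). Qed.

Lemma bimult1 v : P cone v = ej *: v.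
Proof. by rewrite /bimult /opposite !(rep1 pP) JJ. Qed.

Section Commute.
Variables (I : Type) (U : I -> A).
Hypothesis U_unitary : forall i, cunitary (U i).
Hypothesis U_gen : forall S : set A, cstar_subalg S -> (forall i, S (U i)) ->
  forall a, S a.
Hypothesis opU : forall i k v, op (U k) (p (U i) v) = p (U i) (op (U k) v).

(** Two passes of the commutant argument: b runs over the algebra while a is a
    generator, then, conjugating by J, the roles are exchanged and a runs over
    the algebra while b is a generator. *)
Lemma opposite_commute a b v : op a (p b v) = p b (op a v).
Proof.
have h1 k c w : op (U k) (p c w) = p c (op (U k) w).
  apply: (commutant pP U_unitary U_gen (opposite_linear (U k))
    (opposite_rbounded (U k))) => i u; exact: opU.
have ejI (u w : H) : ej *: u = ej *: w -> u = w.
  by move=> /(congr1 (fun x => ej *: x)); rewrite !scalerA ej2 !scale1r.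
apply: (commutant pP U_unitary U_gen (opposite_linear a)
  (opposite_rbounded a)) => i u.
have := congr1 J (h1 i a (J u)); rewrite /opposite !JJ.
rewrite (linZ (rep_lin pP (U i))) antilinearZ ejC.
by rewrite (linZ (rep_lin pP a)) antilinearZ ejC => /ejI->.
Qed.

(** Moving the opposite factor of a past p b brings the two copies of J between
    a and b together; they produce the sign of J^2. *)
Lemma bimultM a b v : P a (P b v) = ej *: P (cmul a b) v.
Proof.
rewrite /bimult opposite_commute -(repM pP) /opposite JJ.
by rewrite (linZ (rep_lin pP _)) antilinearZ ejC (linZ (rep_lin pP _)) -(repM pP).
Qed.

End Commute.
End RealStructure.

(** * Spectral triples in their eigenbasis *)

Section Sign.
Variables (R : realType) (n : nat).

Lemma eps_J_conj : Num.conj (eps_J R n) = eps_J R n.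
Proof.
rewrite /eps_J; have : (n %% 8 < 8)%N by rewrite ltn_pmod.
by move: (n %% 8)%N; do 8 ?[case=> [_|] /=; rewrite ?rmorphN1 ?rmorph1//].
Qed.

Lemma eps_J_sqr : eps_J R n * eps_J R n = 1.
Proof.
rewrite /eps_J; have : (n %% 8 < 8)%N by rewrite ltn_pmod.
by move: (n %% 8)%N; do 8 ?[case=> [_|] /=; rewrite ?mulrNN ?mulr1//].
Qed.

End Sign.

Section SpinTriple.
Variables (R : realType) (n : nat) (theta : 'M[R]_n) (A : cstarAlg R).
Variables (U : 'cV[int]_n -> A) (eps : 'cV[R]_n) (T : spectral_tuple A).
Variables (e : 'cV[R]_n -> 'I_(spin_dim n) -> st_H T) (bA : 'M[R]_n)
    (tau : 'I_n -> 'cV[R]_n) (g : 'I_n -> 'M[R[i]]_(spin_dim n))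
    (C : 'M[R[i]]_(spin_dim n)) (Cop : st_H T -> st_H T)
    (Lambda : 'M[R[i]]_(spin_dim n)).
Hypothesis sta : spin_triple_axioms theta U eps e bA tau g C Cop Lambda.
Hypothesis spin_eps : spin_structure eps.

Local Notation p := (st_pi (s := T)).
Local Notation J := (@st_J _ _ T).
Local Notation L := (shifted_lattice eps).
Local Notation q x y := (dotv x (bA *m y)).

Lemma rep_mact M x mu j : L mu ->
  p (U x) (mact e M mu j) =
  expi (2^-1 * q (zvec R x) (zvec R x) + q (zvec R x) mu)
    *: mact e M (mu + zvec R x) j.
Proof.
move=> muL; have lp := rep_lin (sta_rep sta) (U x).
rewrite /mact scaler_sumr; elim/big_rec2: _ => [|k _ w _ <-].
  exact: lin0 lp.
by rewrite lp (sta_pi sta)// !scalerA mulrC.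
Qed.

(** Read off from J^2 applied to e_(-mu), using that J is antilinear. Working
    with the combinations Lambda e_(mu, j) avoids computing
    Lambda times its complex conjugate. *)
Lemma J_mact mu j : L mu ->
  J (mact e Lambda mu j) = (eps_J R n * expi (q mu mu)) *: e (- mu) j.
Proof.
move=> muL; have := sta_JJ sta (e (- mu) j).
rewrite (sta_J sta); last exact: shifted_latticeN.
rewrite mulmxN dotvNl dotvNr !opprK (antilinearZ (sta_J_isom sta)) conj_expi.
move=> /(congr1 (fun v => expi (q mu mu) *: v)); rewrite !scalerA.
by rewrite -expiD subrr expi0 scale1r mulrC.
Qed.

Lemma opposite_basis x mu j : L mu ->
  opposite p J (U x) (e mu j) =
  (eps_J R n * expi (2^-1 * q (zvec R x) (zvec R x) - q mu (zvec R x)))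
    *: e (mu - zvec R x) j.
Proof.
move=> muL; have muL' := shifted_latticeN spin_eps muL.
have lp := rep_lin (sta_rep sta) (U x).
rewrite /opposite (sta_J sta)// (linZ lp) rep_mact// scalerA.
rewrite (antilinearZ (sta_J_isom sta)) J_mact; last exact: shifted_latticeD.
rewrite scalerA opprD opprK -expiD conj_expi mulrCA -expiD.
congr ((_ * expi _) *: _).
rewrite !mulmxDr !mulmxN !dotvDl !dotvDr !dotvNl !dotvNr.
lra.
Qed.

Lemma opposite_commute_gen x y v :
  opposite p J (U y) (p (U x) v) = p (U x) (opposite p J (U y) v).
Proof.
have lp := rep_lin (sta_rep sta); have bp := rep_rbounded (sta_rep sta).
have lo a := opposite_linear (sta_rep sta) (sta_J_isom sta) a.
have bo a := opposite_rbounded (sta_rep sta) (sta_J_isom sta) a.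
apply: (linear_eq_on_basis (sta_basis sta) (F := opposite p J (U y) \o p (U x))
  (G := p (U x) \o opposite p J (U y))) => /=.
- by move=> c u w /=; rewrite lp lo.
- exact: rbounded_comp (bo _) (bp _).
- by move=> c u w /=; rewrite lo lp.
- exact: rbounded_comp (bp _) (bo _).
move=> mu j muL.
rewrite (sta_pi sta)// (linZ (lo _)) !opposite_basis//; last first.
  exact: shifted_latticeD.
rewrite (linZ (lp _)) (sta_pi sta) -?zvecN; last exact: shifted_latticeD.
rewrite zvecN !scalerA mulrCA -mulrA -!expiD [mu + _ - _]addrAC.
congr ((_ * expi _) *: _).
rewrite !mulmxDr !mulmxN !dotvDl !dotvDr !dotvNr.
lra.
Qed.

(** The phases depending on A combine into x . A mu - mu . A x, that is
    x . (A - A^t) mu. *)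
Lemma bimult_basis x mu j : L mu ->
  bimult p J (U x) (e mu j) =
  (eps_J R n * expi (dotv (zvec R x) (theta *m mu))) *: e mu j.
Proof.
move=> muL; rewrite /bimult opposite_basis//.
rewrite (linZ (rep_lin (sta_rep sta) _)) (sta_pi sta) -?zvecN; last first.
  exact: shifted_latticeD.
rewrite zvecN addrNK scalerA -mulrA -expiD.
congr ((_ * expi _) *: _).
rewrite -(sta_bA sta) mulmxBl !mulmxDr !mulmxN !dotvDr !dotvNr dotv_trmx.
lra.
Qed.

(** A nonzero f has a nonzero coefficient on some basis vector e_mu. Since P(U_x)
    is diagonal it multiplies this coefficient by the eigenvalue at mu;
    comparing with c(x) determines c. *)
Lemma bimult_eigenvalue (f : st_H T) (c : 'cV[int]_n -> R[i]) : f != 0 ->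
  (forall x, bimult p J (U x) f = c x *: f) ->
  exists2 mu, L mu &
    forall x, c x = eps_J R n * expi (dotv (zvec R x) (theta *m mu)).
Proof.
move=> f0 fc.
have [[mu [j [muL fmu]]]|nomu] :=
    pselect (exists mu j, L mu /\ hdot _ f (e mu j) != 0); last first.
  case/eqP: f0; apply: (ortho_basis_eq0 (sta_basis sta)) => mu j muL.
  by apply: contrapT => /eqP fmu; apply: nomu; exists mu, j.
exists mu => // x; set l := RHS.
have [le be] := hdot_functional (e mu j).
have lP := bimult_linear (sta_rep sta) (sta_J_isom sta) (U x).
have bP := bimult_rbounded (sta_rep sta) (sta_J_isom sta) (U x).
have [N N0 bN] := be.
pose F v : R[i]^o := hdot _ (bimult p J (U x) v) (e mu j).
pose G v : R[i]^o := l *: (hdot _ v (e mu j) : R[i]^o).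
have FG : F =1 G.
  apply: (linear_eq_on_basis (sta_basis sta)).
  - by move=> a u v; rewrite /F lP le.
  - exact: rbounded_comp be bP.
  - by move=> a u v; rewrite /G hdotDl hdotZl scalerDr !scalerA mulrC.
  - exists (rnorm (l : R[i]^o) * N) => [|v]; first by rewrite mulr_ge0 ?rnorm_ge0.
    rewrite -lecR -rnormE normrZ -mulrA !rmorphM/= -rnormE ler_wpM2l//.
    by rewrite rnormE -rmorphM lecR.
  move=> nu k nuL; rewrite /F /G bimult_basis// hdotZl (sta_basis sta).1//.
  by case: (eqVneq nu mu) => [->|_] //=; rewrite mulr0 scaler0.
have := FG f; rewrite /F /G fc hdotZl => /mulIf; exact.
Qed.

End SpinTriple.

(** * Resonant deformation parameters *)

Section Resonances.
Variables (R : realType) (n : nat) (n_gt1 : (1 < n)%N).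

Definition resonant : set 'M[R]_n := [set t | antisym_mx t /\
  exists (k : 'cV[int]_n) (i j : 'I_n) (z : int),
    [/\ i != j, k i 0 != 0 & (t *m zvec R k) j 0 = z%:~R]].

Lemma antisym_null_resonant : antisym_null resonant.
Proof.
pose F (q : 'cV[int]_n * 'I_n * 'I_n * int) := let: (k, i, j, z) := q in
  [set t : 'M[R]_n | antisym_mx t /\
    [/\ i != j, k i 0 != 0 & (t *m zvec R k) j 0 = z%:~R]].
have -> : resonant = \bigcup_q F q.
  apply/seteqP; split=> [t [ta [k [i [j [z h]]]]]|t [[[[k i] j] z] _ [ta h]]].
    by exists (k, i, j, z).
  by split=> //; exists k, i, j, z.
apply: (antisym_null_bigcup_countable n_gt1) => -[[[k i] j] z].
have [/andP[ij ki]|nijk] := boolP ((i != j) && (k i 0 != 0)).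
  apply: (antisym_null_sub _
    (antisym_null_hyperplane (k := zvec R k) n_gt1 z%:~R ij _)).
    by move=> t [ta [_ _ h]].
  by rewrite mxE intr_eq0.
apply: (antisym_null_sub _ (antisym_null0 R n_gt1)) => t [_ [ij ki _]].
by move: nijk; rewrite ij ki.
Qed.

(** Testing equality of the phases on the unit vectors shows that
    theta (mu - nu) is integral. The vector k = 2 (mu - nu) is
    integral, and it has an odd entry k_i at an index where eps and eps' differ;
    any j <> i then gives a resonance. *)
Lemma distinct_spin_characters (theta : 'M[R]_n) (eps eps' mu nu : 'cV[R]_n) :
  antisym_mx theta -> ~ resonant theta ->
  spin_structure eps -> spin_structure eps' -> eps <> eps' ->
  shifted_lattice eps mu -> shifted_lattice eps' nu ->
  ~ forall x : 'cV[int]_n, expi (dotv (zvec R x) (theta *m mu))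
                         = expi (dotv (zvec R x) (theta *m nu)).
Proof.
move=> ta nres sp sp' neps [m muE] [m' nuE] same; apply: nres; split=> //.
have [i epsi] : exists i, eps i 0 != eps' i 0.
  apply: contrapT => h; apply: neps; apply/matrixP => i j; rewrite ord1.
  by apply/eqP/negPn/negP => hi; apply: h; exists i.
pose k := (m - m') + (m - m') + (half_index eps - half_index eps').
have kE : zvec R k = (mu - nu) + (mu - nu).
  apply/matrixP => a b; rewrite /k !zvecD !zvecN -!double_spin// muE nuE !mxE.
  ring.
have [j ij] : exists j, i != j.
  have [i0|i0] := eqVneq (val i) 0%N; last first.
    by exists (Ordinal (ltnW n_gt1)); rewrite -val_eqE.
  by exists (Ordinal n_gt1); rewrite -val_eqE /= i0.
have [z jz] := expi_eq (same (delta_mx j 0)).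
exists k, i, j, (z + z); split=> //.
  have half0 : (2^-1 : R) != 0 by rewrite invr_neq0// pnatr_eq0.
  have : (eps i 0 != 0) != (eps' i 0 != 0).
    move: epsi; case: (sp i) => ->; case: (sp' i) => ->;
      by rewrite ?half0 ?eqxx.
  rewrite !mxE; move: (eps i 0 != 0) (eps' i 0 != 0) (m i 0) (m' i 0).
  by case; case=> // x y _; rewrite /=; lia.
have dE y : dotv (zvec R (delta_mx j 0)) y = y j 0.
  rewrite /dotv mxE (bigD1 j)//= !mxE !eqxx mul1r big1 ?addr0// => l lj.
  by rewrite !mxE (negbTE lj) mul0r.
by rewrite intrD -jz !dE kE mulmxDr mulmxBr !mxE.
Qed.

End Resonances.

Theorem theoremB (R : realType) (n : nat) (hn : (2 <= n)%N) :
  exists N : set 'M[R]_n, antisym_null N /\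
  forall theta : 'M[R]_n, antisym_mx theta -> ~ N theta ->
  forall (A : cstarAlg R) (U : 'cV[int]_n -> A), is_nc_torus theta U ->
  forall eps eps' : 'cV[R]_n, spin_structure eps -> spin_structure eps' ->
    eps <> eps' ->
  forall T T' : spectral_tuple A,
    real_spectral_triple theta U eps T ->
    real_spectral_triple theta U eps' T' ->
  ~ exists (W : st_H T -> st_H T') (sigma : A -> A),
      unitary_equivalence U W sigma /\ inner_automorphism sigma.
Proof.
exists (@resonant R n); split; first exact: antisym_null_resonant.
move=> theta ta nres A U [[Uu _] Ugen _] eps eps' sp sp' neps T T'.
move=> [e [bA [tau [g [C [Cop [Lam sta]]]]]]].
move=> [e' [bA' [tau' [g' [C' [Cop' [Lam' sta']]]]]]].
move=> [W [sigma [eqW [u [usu uus] sigmaE]]]].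
have j0 : 'I_(spin_dim n) by exists 0%N; rewrite expn_gt0.
pose p := st_pi (s := T); pose p' := st_pi (s := T').
pose J := @st_J _ _ T; pose J' := @st_J _ _ T'.
have ejC : Num.conj (eps_J R n) = eps_J R n := eps_J_conj R n.
have ej2 : eps_J R n * eps_J R n = 1 := eps_J_sqr R n.
have lW : linear W by case: (ueq_unitary eqW).
have mu0 : shifted_lattice eps eps.
  by exists 0; rewrite -[0]subr0 zvecD zvecN subrr add0r.
pose v := e eps j0.
have Wv0 : W v != 0.
  have [_ _ Wdot] := ueq_unitary eqW.
  apply/eqP => Wv; have := Wdot v v; rewrite Wv linear0l (sta_basis sta).1//.
  by rewrite !eqxx => /esym/eqP; rewrite oner_eq0.
have PM := bimultM (sta_rep sta') (sta_J_isom sta') ejC ej2 (sta_JJ sta') Uu Ugen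
  (fun i k w => opposite_commute_gen sta' sp' i k w).
have lP a := bimult_linear (sta_rep sta') (sta_J_isom sta') a.
have P1 := bimult1 (sta_rep sta') (sta_JJ sta').
have WP x w : W (bimult p J (U x) w) = bimult p' J' (sigma (U x)) (W w).
  rewrite /bimult /opposite (ueq_pi eqW); last exact: smooth_generator.
  rewrite (ueq_J eqW) (ueq_pi eqW); last exact: smooth_generator.
  by rewrite (ueq_J eqW).
(* The candidate joint eigenvector for the second triple. *)
pose f := bimult p' J' (cstar u) (W v).
have f0 : f != 0.
  apply/eqP => f0; have := PM u (cstar u) (W v); rewrite -/p' -/J' -/f f0 uus P1.
  rewrite (lin0 (lP u)) scalerA ej2 scale1r => /esym/eqP.
  exact/negP.
pose c x := eps_J R n * expi (dotv (zvec R x) (theta *m eps)).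
have fc x : bimult p' J' (U x) f = c x *: f.
  rewrite /f PM.
  have -> : cmul (U x) (cstar u) = cmul (cstar u) (sigma (U x)).
    by rewrite sigmaE !cmulA usu cmul1l.
  by rewrite -PM -WP (bimult_basis sta sp)// (linZ lW) (linZ (lP _)).
have [nu nuL cE] := bimult_eigenvalue sta' sp' f0 fc.
apply: (distinct_spin_characters hn ta nres sp sp' neps mu0 nuL) => x.
have := cE x; rewrite /c => /(congr1 (fun y => eps_J R n * y)).
by rewrite !mulrA ej2 !mul1r.
Qed.
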